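(* Let $V$ be a finite set with $|V|=n$. Suppose $\alpha=\sum_{\ell=2}^n w_\ell\,\alpha^\ell$ for some nonnegative vector $w=(w_2,\dots,w_n)$, where $\alpha^\ell$ denotes the collection of weights $\alpha^\ell_A=\mathbf 1_{|A|=\ell}$, $A\subset V$. Then $$\kappa[\alpha]=\sum_{\ell=2}^n w_\ell\,\frac{\binom{n-1}{\ell-1}\log \ell}{\log n},$$ and equality in the inequality $$\kappa\,\mathrm{Ent} f\le\frac1n\sum_{A\subset V}|A|\,\alpha_A\,\mathrm{ent}_A f$$ (with $\kappa=\kappa[\alpha]$) is uniquely achieved at multiples of a Dirac mass.
   Context: Let $\mu$ be the uniform distribution on $V$. For $f:V\to[0,\infty)$, $\mathrm{Ent} f=\mu[f\log(f/\mu(f))]$ is the relative entropy of $f$ with respect to $\mu$ (with $0\log 0=0$). For $A\subset V$, $\mathrm{ent}_A f=\frac1{|A|}\sum_{x\in A}f(x)\log (f(x)/\bar f_A)$ with $\bar f_A=\frac1{|A|}\sum_{x\in A}f(x)$. Given a collection of nonnegative weights $\alpha=\{\alpha_A,\ A\subset V\}$, the entropy constant $\kappa[\alpha]$ is the largest $\kappa\ge 0$ such that for all $f:V\to[0,\infty)$, $$\kappa\,\mathrm{Ent} f\le \frac1n\sum_{A\subset V}|A|\,\alpha_A\,\mathrm{ent}_A f .$$ A Dirac mass is a function of the form $f(x)=\mathbf 1_{x=x_0}$ for a fixed $x_0\in V$.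
   Formalization: Assumes n ≥ 2 (for n=1 the formula is 0/0). Uniqueness of equality is claimed only for nonconstant f and when w_ℓ>0 for some 2≤ℓ<n, since constant f always give equality, and if only w_n can be nonzero every f gives equality. *)

(* Defs.v *)
From mathcomp Require Import all_boot all_order all_algebra.
From mathcomp Require Import all_classical all_reals all_analysis.

Set Implicit Arguments.
Unset Strict Implicit.
Unset Printing Implicit Defensive.

Import Order.TTheory GRing.Theory Num.Theory.
Local Open Scope ring_scope.

(* The convention 0 log 0 = 0 holds automatically below: whenever the argument
   of [ln] is 0 or a 0/0, the logarithm is multiplied by [f x = 0]. *)

Definition mean (R : realType) (V : finType) (A : {set V}) (f : V -> R) : R :=
  (#|A|%:R)^-1 * \sum_(x in A) f x.

Definition ent_on (R : realType) (V : finType) (A : {set V}) (f : V -> R) : R :=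
  mean A (fun x => f x * ln (f x / mean A f)).

Definition unif (R : realType) (V : finType) (f : V -> R) : R :=
  (#|V|%:R)^-1 * \sum_x f x.

Definition Ent (R : realType) (V : finType) (f : V -> R) : R :=
  unif (fun x => f x * ln (f x / unif f)).

Definition local_ent (R : realType) (V : finType) (alpha : {set V} -> R)
    (f : V -> R) : R :=
  (#|V|%:R)^-1 * \sum_(A : {set V}) #|A|%:R * alpha A * ent_on A f.

Definition admissible (R : realType) (V : finType) (alpha : {set V} -> R) :
    set R :=
  [set k | 0 <= k /\
    forall f : V -> R, (forall x, 0 <= f x) -> k * Ent f <= local_ent alpha f].

(* A relation rather than a total function, so that [kappa] being the entropy
   constant includes the fact that a largest admissible value exists. *)
Definition is_entropy_constant (R : realType) (V : finType)
    (alpha : {set V} -> R) (kappa : R) : Prop :=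
  admissible alpha kappa /\ ubound (admissible alpha) kappa.

Definition level_weights (R : realType) (V : finType) (l : nat) :
    {set V} -> R :=
  fun A => (#|A| == l)%:R.

Definition dirac_mass (R : realType) (V : finType) (x0 : V) : V -> R :=
  fun x => (x == x0)%:R.

Definition dirac_multiple (R : realType) (V : finType) (f : V -> R) : Prop :=
  exists (c : R) (x0 : V), forall x, f x = c * dirac_mass R x0 x.

Definition constant_fun (R : realType) (V : finType) (f : V -> R) : Prop :=
  exists c : R, forall x, f x = c.

(* Main.v *)
(* Let U(A) = |A| ent_A f / log |A|.  The theorem reduces to the single step
   (|B| - 1) U(B) <= \sum_(x in B) U(B \ x) for |B| >= 3: averaging it over
   all B of a given size and descending from B = V bounds each level sum
   \sum_(|A| = l) U(A) from below by C(n-1, l-1) U(V).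

   With m = |B| - 1, eta(x) = - x log x, f normalised to p with total mass 1 on
   B, and c_m = m (1 - log m / log (m+1)), the step reads
   c_m \sum_x eta(p_x) <= \sum_x eta(1 - p_x).
   It is proved by induction on |B|.  Remove the largest atom; the others have
   mass s <= m/(m+1) and equal s q with q of mass 1.  Convexity of
   q |-> eta(1 - s q) - s^2 eta(1 - q) compares \sum eta(1 - s q) with the
   uniform q up to s^2 times the same deficit at s = 1, which the induction
   hypothesis controls.  Since c_{m-1} m/(m+1) <= c_m, what remains is the case
   where q is uniform, an inequality in s alone that is strict for
   0 < s < m/(m+1): s = 0 is the Dirac mass and s = m/(m+1) the uniform one. *)

Require Import Defs.
From mathcomp Require Import all_boot all_order all_algebra.
From mathcomp Require Import all_classical all_reals all_analysis.
From mathcomp Require Import ring lra zify.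

Set Implicit Arguments.
Unset Strict Implicit.
Unset Printing Implicit Defensive.

Import Order.TTheory GRing.Theory Num.Theory.
Local Open Scope ring_scope.

(** * Calculus: monotonicity, derivatives of [eta], tangent lines *)

Lemma is_derive_lt (R : realType) (f f' : R -> R) (a b : R) :
  a < b -> (forall x, a <= x <= b -> is_derive x 1 f (f' x)) ->
  (forall x, a < x < b -> 0 < f' x) -> f a < f b.
Proof.
move=> ab df f'_gt0.
have [x||c] := @MVT R f f' a b ab.
- by rewrite in_itv /= => /andP[ax xb]; apply: df; rewrite !ltW.
- apply: derivable_within_continuous => x; rewrite in_itv /= => axb.
  by case: (df x axb).
- by rewrite in_itv /= => acb fE; rewrite -subr_gt0 fE mulr_gt0 ?f'_gt0 ?subr_gt0.
Qed.

Lemma is_derive_le (R : realType) (f f' : R -> R) (a b : R) :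
  a <= b -> (forall x, a <= x <= b -> is_derive x 1 f (f' x)) ->
  (forall x, a < x < b -> 0 <= f' x) -> f a <= f b.
Proof.
rewrite le_eqVlt => /predU1P[->//|ab] df f'_ge0.
have [x||c] := @MVT R f f' a b ab.
- by rewrite in_itv /= => /andP[ax xb]; apply: df; rewrite !ltW.
- apply: derivable_within_continuous => x; rewrite in_itv /= => axb.
  by case: (df x axb).
- rewrite in_itv /= => acb fE.
  by rewrite -subr_ge0 fE mulr_ge0 ?f'_ge0 // subr_ge0 ltW.
Qed.

Lemma is_derive_ln1B (R : realType) (s x : R) : s * x < 1 ->
  is_derive x 1 (fun y : R => ln (1 - s * y)) (- s / (1 - s * x)).
Proof.
move=> sx1; have h : 0 < 1 - s * x by rewrite subr_gt0.
have d1 : is_derive x 1 (fun y : R => 1 - s * y) (- s).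
  have -> : (fun y : R => 1 - s * y) = (cst 1 - cst s * id : R -> R) by [].
  apply: is_derive_eq; rewrite /GRing.scale /=; ring.
have d2 := @is_derive1_ln R _ h.
have d := @is_derive1_comp R (@ln R) (fun y => 1 - s * y) x _ _ d2 d1.
by apply: (is_derive_eq d); rewrite mulrC.
Qed.

Definition eta (R : realType) (x : R) : R := - x * ln x.

Lemma is_derive_eta1B (R : realType) (s x : R) : s * x < 1 ->
  is_derive x 1 (fun y : R => eta (1 - s * y)) (s * ln (1 - s * x) + s).
Proof.
move=> sx1; have h : 1 - s * x != 0 by rewrite gt_eqF // subr_gt0.
have d := is_derive_ln1B sx1.
have -> : (fun y : R => eta (1 - s * y)) =
  ((cst s * id - cst 1) * (fun y => ln (1 - s * y)) : R -> R).
  by apply/funext => y /=; rewrite /eta /GRing.mul /= opprB.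
apply: is_derive_eq; rewrite /GRing.scale /=.
have -> : (cst s * id - cst 1 : R -> R) x = s * x - 1 by [].
by field.
Qed.

(** Since [f'] is monotone on [I], the function [f y - f' a * y] decreases before [a] and increases
    after it. The interval [I] is left general because the application is to the half-open [[0,
    1[]. *)
Lemma is_derive_tangent (R : realType) (f f' f'' : R -> R) (I : interval R)
    (a x : R) :
  (forall y, y \in I -> is_derive y 1 f (f' y)) ->
  (forall y, y \in I -> is_derive y 1 f' (f'' y)) ->
  (forall y, y \in I -> 0 <= f'' y) ->
  a \in I -> x \in I -> f a + f' a * (x - a) <= f x.
Proof.
move=> df df' f''_ge0 aI xI.
have Iconv y z t : y \in I -> z \in I -> y <= t <= z -> t \in I.
  by move=> yI zI /andP[yt tz]; apply: (interval_is_interval yI zI); rewrite yt.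
have f'_le y z : y \in I -> z \in I -> y <= z -> f' y <= f' z.
  move=> yI zI yz; apply: (@is_derive_le _ f' f'' _ _ yz) => t.
    by move=> /(Iconv y z t yI zI) /df'.
  by move=> /andP[/ltW yt /ltW tz]; apply: f''_ge0; apply: (Iconv y z) => //; rewrite yt.
pose g y := f y - f' a * y.
have dg y : y \in I -> is_derive y 1 g (f' y - f' a).
  move=> yI; have d := df _ yI.
  have -> : g = (f - cst (f' a) * id : R -> R) by [].
  by apply: is_derive_eq; rewrite /GRing.scale /=; ring.
suff : g a <= g x by rewrite /g; lra.
have [ax|xa] := leP a x.
  apply: (@is_derive_le _ g (fun y => f' y - f' a) _ _ ax) => t.
    by move=> /(Iconv a x t aI xI) /dg.
  by move=> /andP[/ltW at_ /ltW tx]; rewrite subr_ge0 f'_le // (Iconv a x) // at_.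
rewrite -lerN2.
apply: (@is_derive_le _ (- g) (fun y => - (f' y - f' a)) _ _ (ltW xa)) => t.
  by move=> /(Iconv x a t xI aI) /dg d; apply: is_deriveN.
by move=> /andP[/ltW xt /ltW ta]; rewrite oppr_ge0 subr_le0 f'_le // (Iconv x a) // xt.
Qed.

(** * Convex comparison with the uniform vector *)

Lemma ln_ge_1BV (R : realType) (x : R) : 0 < x -> 1 - x^-1 <= ln x.
Proof.
move=> x0; have xV : -1 < x^-1 - 1 by rewrite ltrBrDl subrr invr_gt0.
by have := le_ln1Dx xV; rewrite addrCA subrr addr0 lnV //; lra.
Qed.

Lemma eta0 (R : realType) : eta 0 = 0 :> R.
Proof. by rewrite /eta oppr0 mul0r. Qed.

Lemma eta1 (R : realType) : eta 1 = 0 :> R.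
Proof. by rewrite /eta ln1 mulr0. Qed.

Lemma etaM (R : realType) (s x : R) : 0 < s -> 0 <= x ->
  eta (s * x) = x * eta s + s * eta x.
Proof.
move=> s0; rewrite le_eqVlt => /predU1P[<-|x0].
  by rewrite mulr0 eta0 mul0r mulr0 addr0.
by rewrite /eta lnM ?posrE //; ring.
Qed.

(** The right side has second derivative [s ^+ 2 / (1 - q) - s ^+ 2 / (1 - s * q)], nonnegative
    because [s <= 1]. The factor [s ^+ 2] is the smallest that keeps it nonnegative at [q = 0]. *)
Lemma eta1B_tangent (R : realType) (s a q : R) :
  0 <= s < 1 -> 0 <= a < 1 -> 0 <= q <= 1 ->
  eta (1 - s * a) - s ^+ 2 * eta (1 - a)
    + (s * ln (1 - s * a) + s - s ^+ 2 * (ln (1 - a) + 1)) * (q - a)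
  <= eta (1 - s * q) - s ^+ 2 * eta (1 - q).
Proof.
move=> /andP[s0 s1] /andP[a0 a1] /andP[q0]; rewrite le_eqVlt => /predU1P[->|q1].
  (* eta (1 - q) is not differentiable at q = 1. *)
  rewrite subrr eta0 mulr1 /eta.
  have sa1 : s * a < 1 by rewrite (le_lt_trans _ s1) // ler_piMr // ltW.
  have [z1 z0] : 0 < 1 - s /\ 0 < 1 - s * a by split; rewrite subr_gt0.
  have := @ln_ge_1BV R ((1 - s * a) / (1 - s)) (divr_gt0 z0 z1).
  rewrite invf_div ln_div ?posrE // => h.
  (* The terms in [ln (1 - a)] cancel and a common factor [1 - s] comes out. *)
  suff : s * (1 - a) <= ln (1 - s * a) - ln (1 - s) by nra.
  apply: le_trans h.
  have -> : 1 - (1 - s) / (1 - s * a) = s * (1 - a) / (1 - s * a).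
    by field; rewrite gt_eqF.
  rewrite ler_pdivlMr // ler_piMr //; first by rewrite mulr_ge0 // subr_ge0 ltW.
  by rewrite gerBl mulr_ge0.
have lt1 (y : R) : y \in `[0, 1[ -> (s * y < 1) /\ (1 * y < 1).
  rewrite in_itv /= mul1r => /andP[y0 y1]; split=> //.
  by rewrite (le_lt_trans _ y1) // ler_piMl // ltW.
pose f y := eta (1 - s * y) - s ^+ 2 * eta (1 - 1 * y).
pose f' y := s * ln (1 - s * y) + s - s ^+ 2 * (1 * ln (1 - 1 * y) + 1).
pose f'' y := s ^+ 2 / (1 - y) - s ^+ 2 / (1 - s * y).
suff : f a + f' a * (q - a) <= f q by rewrite /f /f' !mul1r.
have aI : a \in `[0, 1[ by rewrite in_itv /= a0.
have qI : q \in `[0, 1[ by rewrite in_itv /= q0.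
apply: (is_derive_tangent _ _ _ aI qI (f'' := f'')).
- move=> y /lt1[sy y1]; rewrite /f /f'.
  have d1 := is_derive_eta1B sy; have d2 := is_derive_eta1B y1.
  have -> : (fun y => eta (1 - s * y) - s ^+ 2 * eta (1 - 1 * y)) =
    ((fun y => eta (1 - s * y)) - cst (s ^+ 2) * (fun y => eta (1 - 1 * y)) : R -> R).
    by [].
  by apply: is_derive_eq; rewrite /GRing.scale /=; ring.
- move=> y /lt1[sy y1]; rewrite /f' /f''.
  have d1 := is_derive_ln1B sy; have d2 := is_derive_ln1B y1.
  have -> : (fun y => s * ln (1 - s * y) + s - s ^+ 2 * (1 * ln (1 - 1 * y) + 1)) =
    (cst s * (fun y => ln (1 - s * y)) + cst s -
     cst (s ^+ 2) * ((fun y => ln (1 - 1 * y)) + cst 1) : R -> R).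
    by apply/funext => z /=; rewrite mul1r.
  have [z1 z0] : 1 - y != 0 /\ 1 - s * y != 0.
    by rewrite mul1r in y1; split; rewrite gt_eqF // subr_gt0.
  by apply: is_derive_eq; rewrite /GRing.scale /= mul1r; field; rewrite z0.
- move=> y yI; rewrite /f''; have [sy] := lt1 _ yI; rewrite mul1r => y1.
  rewrite subr_ge0 ler_wpM2l ?sqr_ge0 // lef_pV2 ?posrE ?subr_gt0 //.
  by move: yI; rewrite in_itv /= => /andP[y0 _]; rewrite lerB // ler_piMl // ltW.
Qed.

(** The tangent bound at [a = #|B|%:R^-1], summed over [B]: the linear terms cancel because [q] has
    mean [a]. *)
Lemma sum_eta1B_scale (R : realType) (V : finType) (B : {set V}) (q : V -> R) (s : R) :
  (1 < #|B|)%N -> 0 <= s < 1 -> (forall x, x \in B -> 0 <= q x) ->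
  \sum_(x in B) q x = 1 ->
  #|B|%:R * (eta (1 - s / #|B|%:R) - s ^+ 2 * eta (1 - #|B|%:R^-1))
    + s ^+ 2 * \sum_(x in B) eta (1 - q x) <= \sum_(x in B) eta (1 - s * q x).
Proof.
move=> B1 s01 q0 q1; set m : R := #|B|%:R.
have m1 : 1 < m by rewrite ltr1n.
have m0 : 0 < m by rewrite (lt_trans _ m1).
have q_le1 x : x \in B -> q x <= 1.
  by move=> xB; rewrite -q1 (bigD1 x) //= lerDl sumr_ge0 // => y /andP[/q0].
rewrite -lerBrDr mulr_sumr -sumrB.
set D := s * ln (1 - s * m^-1) + s - s ^+ 2 * (ln (1 - m^-1) + 1).
set K := eta (1 - s / m) - s ^+ 2 * eta (1 - m^-1).
have -> : m * K = \sum_(x in B) (K + D * (q x - m^-1)).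
  rewrite big_split /= sumr_const -mulr_sumr sumrB q1 sumr_const -[K *+ #|B|]mulr_natl.
  by rewrite -[m^-1 *+ _]mulr_natl mulfV ?gt_eqF // subrr mulr0 addr0.
apply: ler_sum => x xB; apply: eta1B_tangent => //.
  by rewrite invr_ge0 ltW //= invf_lt1.
by rewrite q0 // q_le1.
Qed.

(** * One large atom and a uniform rest: the inequality in [s] *)

Lemma is_derive_eta (R : realType) (x : R) :
  0 < x -> is_derive x 1 (@eta R) (- ln x - 1).
Proof.
move=> x0; have d := is_derive1_ln x0.
have -> : @eta R = (- (id * @ln R) : R -> R).
  by apply/funext => y; rewrite /eta mulNr.
by apply: is_derive_eq; rewrite /GRing.scale /=; field; rewrite gt_eqF.
Qed.

(** The ratio of [sum eta (1 - p)] to [sum eta p] for [p] uniform on [m + 1] points, hence the only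
    constant that can be sharp there. *)
Definition shearer_const (R : realType) (m : R) : R := m * (1 - ln m / ln (m + 1)).

Section TwoLevelProfile.
Variables (R : realType) (m : R).
Hypothesis m1 : 1 < m.
Let c := shearer_const m.
(** The mass outside one atom of the uniform vector on [m + 1] points; outside a largest atom the
    mass is never more. *)
Let M := m / (m + 1).

Let m0 : 0 < m. Proof. exact: lt_trans ltr01 m1. Qed.
Let n0 : 0 < m + 1. Proof. by rewrite addr_gt0. Qed.
Let M0 : 0 < M. Proof. exact: divr_gt0. Qed.
Let M_lt1 : M < 1. Proof. by rewrite ltr_pdivrMr // mul1r ltrDl. Qed.
Let ln_m_gt0 : 0 < ln m. Proof. exact: ln_gt0. Qed.
Let ln_n_gt0 : 0 < ln (m + 1). Proof. by apply: ln_gt0; rewrite ltrDr. Qed.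

Let cE : c * ln (m + 1) = m * (ln (m + 1) - ln m).
Proof. by rewrite /c /shearer_const; field; rewrite gt_eqF. Qed.

Let ME : [/\ 1 - M = (m + 1)^-1, 1 - M / m = M, ln M = ln m - ln (m + 1)
  & ln (1 - M) = - ln (m + 1)].
Proof.
have e : 1 - M = (m + 1)^-1 by rewrite /M; field; rewrite gt_eqF.
split=> //; last by rewrite e lnV.
- by rewrite /M; field; rewrite !gt_eqF.
- by rewrite /M ln_div.
Qed.

(* [E s / s ^+ 2] is minus the derivative of [G s / s], for [G] below. *)
Let E y : R := c * ln (1 - y) - m * ln (1 - y / m).

Let c_lt : c < m.
Proof.
by rewrite /c /shearer_const gtr_pMr // ltrBlDr ltrDl divr_gt0.
Qed.

(** [E] vanishes at 0 and, by the choice of [c], at [M]. Its derivative has the sign of a decreasing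
    affine function, so [E] either increases strictly on [[0, s]] or decreases strictly on
    [[s, M]]. *)
Lemma profile_slope_gt0 (s : R) : 0 < s < M -> 0 < E s.
Proof.
move=> /andP[s0 sM].
pose E' y := (m * (1 - c) - y * (m - c)) / ((1 - y) * (m - y)).
have dE y : 0 <= y <= M -> is_derive y 1 E (E' y).
  move=> /andP[y0 yM].
  have y1 : 1 * y < 1 by rewrite mul1r (le_lt_trans yM).
  have ym : m^-1 * y < 1.
    by rewrite mulrC ltr_pdivrMr // mul1r (lt_trans _ m1) // (le_lt_trans yM).
  have d1 := is_derive_ln1B y1; have d2 := is_derive_ln1B ym.
  have -> : E = (cst c * (fun y => ln (1 - 1 * y)) -
                 cst m * (fun y => ln (1 - m^-1 * y)) : R -> R).
    by apply/funext => z; rewrite /E /= -[z in ln (1 - z)]mul1r -[z / m]mulrC.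
  apply: is_derive_eq; rewrite /E' /GRing.scale /=.
  move: y1 ym; rewrite mul1r => y1 ym; field.
  have h : m - y != 0 by rewrite gt_eqF // subr_gt0 (lt_trans _ m1).
  by rewrite h !gt_eqF // subr_gt0.
have E0 : E 0 = 0 by rewrite /E mul0r subr0 ln1 !mulr0 subrr.
have EM : E M = 0.
  rewrite /E; case: ME => _ -> -> ->; have := cE; lra.
have den y : 0 <= y <= M -> 0 < (1 - y) * (m - y).
  move=> /andP[y0 yM]; have y1 := le_lt_trans yM M_lt1.
  by rewrite mulr_gt0 // subr_gt0 // (lt_trans y1).
have [h|h] := leP 0 (m * (1 - c) - s * (m - c)).
  rewrite -E0; apply: (@is_derive_lt _ E E' _ _ s0) => y /andP[y0 ys].
    by apply: dE; rewrite y0 (le_trans ys) // ltW.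
  rewrite divr_gt0 //; last by rewrite den // !ltW //= (lt_trans ys).
  by have := c_lt; nra.
suff : - E s < - E M by rewrite EM oppr0 oppr_lt0.
apply: (@is_derive_lt _ (fun y => - E y) (fun y => - E' y) _ _ sM) => y /andP[sy yM].
  have d : is_derive y 1 E (E' y).
    by apply: dE; rewrite yM andbT (le_trans _ sy) // ltW.
  exact: is_deriveN.
rewrite -mulNr divr_gt0 //; last by rewrite den // (ltW yM) andbT ltW // (lt_trans s0).
by have := c_lt; nra.
Qed.

(* The excess of [sum eta (1 - p)] over [c * sum eta p] when [p] has one atom
   [1 - y] and [m] atoms [y / m]. *)
Let G y : R :=
  (1 - c) * eta y - c * eta (1 - y) + m * eta (1 - y / m) - c * y * ln m.

(** At [M] all [m + 1] atoms are equal, and [c] is defined by equality there. *)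
Lemma profile_uniform : G M = 0.
Proof.
rewrite /G /eta; case: ME => e1 -> eM ->; rewrite e1 eM.
transitivity (m * (ln (m + 1) - ln m) - c * ln (m + 1)).
  by rewrite /M; field; rewrite gt_eqF.
by rewrite cE subrr.
Qed.

(** [G y / y] strictly decreases to its value 0 at [M]. Dividing by [y] turns [y * ln y] and the
    linear terms of [G] into terms that cancel in [G y - y * G' y], which leaves [E y]. *)
Lemma profile_gt0 (s : R) : 0 < s < M -> 0 < G s.
Proof.
move=> /andP[s0 sM].
pose G' y := (1 - c) * (- ln y - 1) - c * (ln (1 - y) + 1)
  + (ln (1 - y / m) + 1) - c * ln m.
have dG y : 0 < y <= M -> is_derive y 1 G (G' y).
  move=> /andP[y0 yM].
  have y1 : 1 * y < 1 by rewrite mul1r (le_lt_trans yM).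
  have ym : m^-1 * y < 1.
    by rewrite mulrC ltr_pdivrMr // mul1r (lt_trans _ m1) // (le_lt_trans yM).
  have d0 := is_derive_eta y0.
  have d1 := is_derive_eta1B y1; have d2 := is_derive_eta1B ym.
  have -> : G = (cst (1 - c) * @eta R - cst c * (fun y => eta (1 - 1 * y))
      + cst m * (fun y => eta (1 - m^-1 * y)) - cst (c * ln m) * id : R -> R).
    apply/funext => z; rewrite /G /= -[z in eta (1 - z)]mul1r -[z / m]mulrC.
    by rewrite [c * z * ln m]mulrAC.
  apply: is_derive_eq; rewrite /G' /GRing.scale /=.
  by rewrite mul1r [y / m]mulrC; field; rewrite gt_eqF.
have GE y : G y - y * G' y = E y.
  by rewrite /G /G' /E /eta; field; rewrite gt_eqF.
rewrite -(pmulr_lgt0 _ (x := s^-1)) ?invr_gt0 //.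
pose Q y := - (G y * y^-1).
suff : Q s < Q M by rewrite /Q profile_uniform mul0r oppr0 oppr_lt0.
apply: (@is_derive_lt _ Q (fun y => E y / y ^+ 2) _ _ sM) => y /andP[sy yM].
  have y0 := lt_le_trans s0 sy; have yn0 : y != 0 by rewrite gt_eqF.
  have d : is_derive y 1 G (G' y) by apply: dG; rewrite y0.
  have dV := @is_deriveV R id y 1 1 yn0 (is_derive_id _ _).
  have -> : Q = (- (G * (fun z => z^-1)) : R -> R) by [].
  apply: is_derive_eq; rewrite /GRing.scale /=.
  by rewrite -GE mulr1; field; rewrite gt_eqF.
have y0 := lt_trans s0 sy.
by rewrite divr_gt0 ?exprn_gt0 // profile_slope_gt0 // y0.
Qed.

Lemma profile_ge0 (s : R) : 0 < s <= M -> 0 <= G s.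
Proof.
move=> /andP[s0]; rewrite le_eqVlt => /predU1P[->|sM].
  by rewrite profile_uniform.
by rewrite ltW // profile_gt0 // s0.
Qed.

End TwoLevelProfile.

(** * Logarithm bounds and the growth of the constants *)

Lemma ln_le_subV (R : realType) (x : R) : 1 <= x -> ln x <= (x - x^-1) / 2.
Proof.
move=> x1; pose f (y : R) := (y - y^-1) / 2 - ln y.
suff : f 1 <= f x by rewrite /f invr1 subrr mul0r ln1; lra.
apply: (@is_derive_le _ f (fun y => (1 - y^-1) ^+ 2 / 2) _ _ x1) => y.
  move=> /andP[y1 _]; have y0 := lt_le_trans ltr01 y1.
  have yn0 : y != 0 by rewrite gt_eqF.
  have d := is_derive1_ln y0; have dV := @is_deriveV R id y 1 1 yn0 (is_derive_id _ _).
  have -> : f = ((id - (fun z => z^-1)) * cst 2^-1 - @ln R : R -> R) by [].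
  by apply: is_derive_eq; rewrite /GRing.scale /= mulr1; field; rewrite gt_eqF.
by move=> _; rewrite divr_ge0 ?sqr_ge0.
Qed.

(** Like the previous bound, this one agrees with [ln] to second order at 1. That precision is used
    for [(m + 1) / m] and [m / (m - 1)], whose logarithms get multiplied by about [m]. *)
Lemma ln_ge_div (R : realType) (x : R) : 1 <= x -> 2 * (x - 1) / (x + 1) <= ln x.
Proof.
move=> x1; pose f (y : R) := ln y + 4 * (y + 1)^-1 - 2.
suff : f 1 <= f x.
  rewrite /f ln1; have -> : 4 * (x + 1)^-1 = 2 - 2 * (x - 1) / (x + 1).
    by field; rewrite gt_eqF //; lra.
  have -> : 4 * (1 + 1)^-1 = 2 :> R by field.
  by lra.
apply: (@is_derive_le _ f (fun y => (y - 1) ^+ 2 / (y * (y + 1) ^+ 2)) _ _ x1) => y.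
  move=> /andP[y1 _]; have y0 := lt_le_trans ltr01 y1.
  have yn0 : y + 1 != 0 by rewrite gt_eqF // addr_gt0.
  have d := is_derive1_ln y0.
  have d1 : is_derive y 1 (fun z : R => z + 1) 1.
    have -> : (fun z : R => z + 1) = (id + cst 1 : R -> R) by [].
    by apply: is_derive_eq; rewrite addr0.
  have dV := @is_deriveV R _ y 1 1 yn0 d1.
  have -> : f = (@ln R + cst 4 * (fun z => (z + 1)^-1) - cst 2 : R -> R) by [].
  by apply: is_derive_eq; rewrite /GRing.scale /= mulr1; field; rewrite yn0 gt_eqF.
by move=> /andP[y1 _]; rewrite divr_ge0 ?sqr_ge0 // mulr_ge0 ?sqr_ge0 //; lra.
Qed.

(** With denominators cleared, [(m - 1) * (ln m - ln (m - 1))] is about [1 - 1 / (2 m)] and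
    [(m + 1) * (ln (m + 1) - ln m)] about [1 + 1 / (2 m)]. This gain of [1 / m], times [ln m], has
    to pay for [ln (m + 1) - ln m], about [1 / m]; hence the role of [1 <= ln m]. *)
Lemma shearer_const_step (R : realType) (k : nat) : (1 < k)%N ->
  k%:R / (k%:R + 1) * shearer_const (k%:R - 1) <= shearer_const k%:R :> R.
Proof.
move=> k1; set m : R := k%:R.
have m2 : 2 <= m by rewrite ler_nat.
have m0 : 0 < m by lra.
have m1 : 0 < m - 1 by lra.
have m3 : 0 < m + 1 by lra.
have lm0 : 0 < ln m by apply: ln_gt0; lra.
have L0 : 0 < ln (m + 1) by apply: ln_gt0; lra.
rewrite /shearer_const subrK.
suff h : (m - 1) * (ln m - ln (m - 1)) * ln (m + 1) <=
         (m + 1) * (ln (m + 1) - ln m) * ln m.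
  rewrite -subr_ge0.
  have -> : m * (1 - ln m / ln (m + 1)) - m / (m + 1) *
      ((m - 1) * (1 - ln (m - 1) / ln m)) =
      m / (m + 1) / (ln m * ln (m + 1)) *
      ((m + 1) * (ln (m + 1) - ln m) * ln m -
       (m - 1) * (ln m - ln (m - 1)) * ln (m + 1)).
    by field; rewrite !gt_eqF.
  by rewrite mulr_ge0 ?subr_ge0 // !divr_ge0 ?mulr_ge0 // ltW.
(* For k = 2 the estimates used below are too weak; there 2 ^ 3 <= 3 ^ 2 suffices. *)
have [k2|k3] := leqP k 2.
  have -> : m = 2 by rewrite /m (_ : k = 2%N) //; apply/eqP; rewrite eqn_leq k2.
  have -> : 2 - 1 = 1 :> R by lra.
  have -> : 2 + 1 = 3 :> R by lra.
  rewrite ln1 subr0 mul1r mulrC ler_wpM2r ?ln_ge0 ?ler1n //.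
  have : ln (2 ^+ 3) <= ln (3 ^+ 2) :> R.
    by rewrite ler_ln ?posrE ?exprn_gt0 // -!natrX ler_nat.
  by rewrite !lnXn //; lra.
have m_ge3 : 3 <= m by rewrite ler_nat.
have lm1 : 1 <= ln m.
  have := @ln_ge_div R m; rewrite (le_trans _ m_ge3) ?ler1n // => /(_ isT).
  by apply: le_trans; rewrite ler_pdivlMr //; lra.
set a := ln (m + 1) - ln m.
have aE : a = ln ((m + 1) / m) by rewrite ln_div.
have x1 : 1 <= (m + 1) / m by rewrite ler_pdivlMr //; lra.
have a_lo : 2 / (2 * m + 1) <= a.
  rewrite aE; apply: le_trans (ln_ge_div x1).
  by rewrite le_eqVlt; apply/predU1P; left; field; rewrite !gt_eqF //; lra.
have a_hi : a <= m^-1.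
  have := @le_ln1Dx R m^-1; rewrite aE (_ : 1 + m^-1 = (m + 1) / m).
    by apply; rewrite (@lt_trans _ _ 0) ?invr_gt0 // oppr_lt0.
  by field; rewrite gt_eqF.
have b_hi : (m - 1) * (ln m - ln (m - 1)) <= 1 - (2 * m)^-1.
  rewrite -ln_div ?posrE // mulrC -ler_pdivlMr //.
  have y1 : 1 <= m / (m - 1) by rewrite ler_pdivlMr //; lra.
  apply: le_trans (ln_le_subV y1) _.
  by rewrite le_eqVlt; apply/predU1P; left; field; rewrite !gt_eqF //; lra.
have -> : ln (m + 1) = ln m + a by rewrite /a; ring.
have u0 : 0 < m^-1 by rewrite invr_gt0.
have b0 : 0 <= 1 - (2 * m)^-1 by rewrite subr_ge0 invf_le1 //; lra.
have lma : 0 <= ln m + a.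
  by rewrite addr_ge0 ?(ltW lm0) // (le_trans _ a_lo) // divr_ge0 //; lra.
apply: (@le_trans _ _ ((1 - (2 * m)^-1) * (ln m + a))); first by rewrite ler_wpM2r.
(* With [b = 1 - (2 * m)^-1], the goal is [b * a <= ((m + 1) * a - b) * ln m], and [1 <= ln m]
   allows that factor to be dropped. *)
have key : (1 - (2 * m)^-1) * a <= (m + 1) * a - (1 - (2 * m)^-1).
  have lo : (2 * m)^-1 + (2 * m + 1)^-1 <= (m + 1) * a - (1 - (2 * m)^-1).
    have -> : (2 * m)^-1 + (2 * m + 1)^-1 =
        (m + 1) * (2 / (2 * m + 1)) - (1 - (2 * m)^-1).
      by field; rewrite !gt_eqF //; lra.
    by rewrite lerB // ler_wpM2l // ltW.
  apply: le_trans lo; apply: (@le_trans _ _ ((1 - (2 * m)^-1) * m^-1)).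
    by rewrite ler_wpM2l.
  rewrite -subr_ge0.
  have -> : (2 * m)^-1 + (2 * m + 1)^-1 - (1 - (2 * m)^-1) / m =
     (m + 1) / (2 * m ^+ 2 * (2 * m + 1)).
    by field; rewrite !gt_eqF //; lra.
  by rewrite divr_ge0 ?mulr_ge0 ?sqr_ge0 //; lra.
have : 0 <= (1 - (2 * m)^-1) * a.
  by rewrite mulr_ge0 // (le_trans _ a_lo) // divr_ge0 //; lra.
nra.
Qed.

(** * The inequality between [sum eta p] and [sum eta (1 - p)] *)

Lemma sum_eta_le_ln (R : realType) (V : finType) (B : {set V}) (q : V -> R) :
  (0 < #|B|)%N -> (forall x, x \in B -> 0 <= q x) -> \sum_(x in B) q x = 1 ->
  \sum_(x in B) eta (q x) <= ln #|B|%:R.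
Proof.
move=> B0 q0 q1; set m : R := #|B|%:R.
have m0 : 0 < m by rewrite ltr0n.
(* Termwise this is [ln u >= 1 - u^-1] at [u = q x * m]; the right sides add up to 0. *)
suff : \sum_(x in B) (eta (q x) - q x * ln m) <= \sum_(x in B) (m^-1 - q x).
  rewrite !sumrB -mulr_suml q1 mul1r sumr_const -[_ *+ _]mulr_natl mulfV ?gt_eqF //.
  by rewrite subrr subr_le0.
apply: ler_sum => x /q0; rewrite le_eqVlt => /predU1P[<-|qx0].
  by rewrite eta0 mul0r !subr0 invr_ge0 ltW.
have := ln_ge_1BV (mulr_gt0 qx0 m0); rewrite lnM ?posrE // => h.
have := ler_wpM2l (ltW qx0) h.
have -> : q x * (1 - (q x * m)^-1) = q x - m^-1 by field; rewrite !gt_eqF.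
by rewrite /eta; lra.
Qed.

(** The induction hypothesis is a premise so that one argument serves both the induction and,
    afterwards, the strict case. Strictness comes from the profile in [s] alone, so a non-strict
    hypothesis at size [k] is enough. *)
Lemma sum_eta_step (R : realType) (V : finType) (k : nat) (B : {set V})
    (p : V -> R) :
  (1 < k)%N -> #|B| = k.+1 ->
  (forall (B' : {set V}) (q : V -> R), #|B'| = k ->
     (forall x, x \in B' -> 0 <= q x) -> \sum_(x in B') q x = 1 ->
     shearer_const (k%:R - 1) * \sum_(x in B') eta (q x) <=
     \sum_(x in B') eta (1 - q x)) ->
  (forall x, x \in B -> 0 <= p x) -> \sum_(x in B) p x = 1 ->
  shearer_const k%:R * \sum_(x in B) eta (p x) <= \sum_(x in B) eta (1 - p x) /\
  ((forall x, x \in B -> p x != 1) ->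
   (exists2 x, x \in B & exists2 y, y \in B & p x != p y) ->
   shearer_const k%:R * \sum_(x in B) eta (p x) < \sum_(x in B) eta (1 - p x)).
Proof.
move=> k1 cardB IH p0 p1; set m : R := k%:R; set c := shearer_const m.
have m1 : 1 < m by rewrite ltr1n.
have m0 : 0 < m by rewrite (lt_trans _ m1).
have n0 : 0 < m + 1 by rewrite addr_gt0.
have [z0 z0B] : exists x, x \in B by apply/card_gt0P; rewrite cardB.
case: (@arg_maxP _ R V z0 (mem B) p z0B) => x0 x0B' x0max.
have x0B : x0 \in B := x0B'.
set t := p x0; pose s := 1 - t.
have cardB' : #|B :\ x0| = k.
  by apply/succn_inj; rewrite -cardB (cardsD1 x0 B) x0B.
have sums (F : V -> R) : \sum_(x in B) F x = F x0 + \sum_(x in B :\ x0) F x.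
  by rewrite (big_setD1 x0).
have rest : \sum_(x in B :\ x0) p x = s by rewrite /s -p1 sums addrAC subrr add0r.
have p0' x : x \in B :\ x0 -> 0 <= p x by rewrite inE => /andP[_ /p0].
have s0 : 0 <= s by rewrite -rest sumr_ge0.
have nt : 1 <= (m + 1) * t.
  rewrite -{1}p1 -[m + 1]/(k%:R + 1%:R) -natrD addn1 -cardB mulr_natl -sumr_const.
  exact: ler_sum.
have sM : s <= m / (m + 1) by rewrite ler_pdivlMr // /s; nra.
have [s_eq0|s_neq0] := eqVneq s 0.
  have t1 : t = 1 by move: s_eq0 => /eqP; rewrite subr_eq0 eq_sym => /eqP.
  have pz x : x \in B :\ x0 -> p x = 0.
    move=> xB; apply/eqP; rewrite eq_le p0' // andbT.
    rewrite -s_eq0 -rest (big_setD1 x) //= lerDl sumr_ge0 // => y.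
    by rewrite inE => /andP[_ /p0'].
  split; last by move=> /(_ x0 x0B); rewrite -/t t1 eqxx.
  rewrite !sums -/t t1 subrr eta0 eta1 !add0r !big1 ?mulr0 // => x /pz ->.
    by rewrite subr0 eta1.
  by rewrite eta0.
have {s_neq0} s_gt0 : 0 < s by rewrite lt_neqAle eq_sym s_neq0.
have s1 : s < 1 by apply: le_lt_trans sM _; rewrite ltr_pdivrMr // mul1r ltrDl.
pose q x := p x / s.
have pE x : p x = s * q x by rewrite /q mulrC divfK // gt_eqF.
have q0 x : x \in B :\ x0 -> 0 <= q x by move=> /p0' ?; rewrite divr_ge0.
have q1 : \sum_(x in B :\ x0) q x = 1 by rewrite -mulr_suml rest divff // gt_eqF.
set H := \sum_(x in B :\ x0) eta (q x).
set J := \sum_(x in B :\ x0) eta (1 - q x).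
have entp : \sum_(x in B) eta (p x) = eta (1 - s) + eta s + s * H.
  rewrite sums -/t; have -> : t = 1 - s by rewrite /s; ring.
  rewrite -addrA; congr (_ + _).
  rewrite -[eta s]mul1r -q1 mulr_suml mulr_sumr -big_split /=.
  by apply: eq_bigr => x xB; rewrite pE etaM // q0.
have copE : \sum_(x in B) eta (1 - p x) = eta s + \sum_(x in B :\ x0) eta (1 - s * q x).
  by rewrite sums -/t -/s; congr (_ + _); apply: eq_bigr => x _; rewrite -pE.
have scale : m * (eta (1 - s / m) - s ^+ 2 * eta (1 - m^-1)) + s ^+ 2 * J <=
    \sum_(x in B :\ x0) eta (1 - s * q x).
  have := @sum_eta1B_scale R V (B :\ x0) q s; rewrite cardB'; apply=> //.
  by rewrite s1 ltW.
have IHq : shearer_const (m - 1) * H <= J by apply: IH.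
have Hm : H <= ln m.
  by rewrite /m -cardB'; apply: sum_eta_le_ln => //; rewrite cardB' ltnW.
(* Equality in the induction hypothesis at the uniform vector on [m] points. *)
have base : m * eta (1 - m^-1) = shearer_const (m - 1) * ln m.
  have -> : 1 - m^-1 = (m - 1) / m by field; rewrite gt_eqF.
  rewrite /shearer_const subrK /eta ln_div ?posrE ?subr_gt0 //.
  by field; rewrite !gt_eqF // ln_gt0.
set c' := shearer_const (m - 1) in IHq base.
have c'0 : 0 <= c'.
  rewrite /c' /shearer_const subrK mulr_ge0 ?subr_ge0 ?ltW //.
  rewrite ltr_pdivrMr ?ln_gt0 // mul1r ltr_ln ?posrE ?subr_gt0 //.
  by rewrite ltrBlDr ltrDl.
have sc : s * c' <= c.
  by apply: le_trans (shearer_const_step R k1); rewrite ler_wpM2r.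
pose G := (1 - c) * eta s - c * eta (1 - s) + m * eta (1 - s / m) - c * s * ln m.
(* By [scale] and [base], the surplus over [G] is at least [s * (ln m - H) * (c - s * c') + s ^+ 2 *
   (J - c' * H)]. *)
have low : G <= \sum_(x in B) eta (1 - p x) - c * \sum_(x in B) eta (p x).
  rewrite entp copE.
  have h1 : 0 <= s * (ln m - H) * (c - s * c').
    by apply: mulr_ge0; [apply: mulr_ge0 => //|]; rewrite subr_ge0.
  have h2 : 0 <= s ^+ 2 * (J - c' * H) by rewrite mulr_ge0 ?sqr_ge0 // subr_ge0.
  have h3 : m * (s ^+ 2 * eta (1 - m^-1)) = s ^+ 2 * (c' * ln m).
    by rewrite -base; ring.
  by move: scale h1 h2 h3; rewrite /G; lra.
split=> [|_ [x xB [y yB pxy]]].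
  rewrite -subr_ge0; apply: le_trans low; apply: profile_ge0 => //.
  by rewrite s_gt0.
rewrite -subr_gt0; apply: lt_le_trans low; apply: profile_gt0 => //.
rewrite s_gt0 lt_neqAle sM andbT.
(* If [s = M], the largest atom equals the average, which forces [p] to be constant. *)
apply: contraNneq pxy => sE.
have tE : (m + 1) * t = 1.
  have -> : t = 1 - s by rewrite /s; ring.
  by rewrite sE; field; rewrite gt_eqF.
have pt z : z \in B -> p z = t.
  move=> zB; apply/eqP; rewrite -subr_eq0 -oppr_eq0 opprB.
  have : \sum_(w in B) (t - p w) = 0.
    by rewrite sumrB p1 sumr_const cardB -mulr_natl -addn1 natrD tE subrr.
  move=> /eqP; rewrite psumr_eq0 => [/allP/(_ z)|w wB].
    by rewrite mem_index_enum zB => /(_ isT).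
  by rewrite subr_ge0; exact: x0max.
by rewrite !pt.
Qed.

Lemma sum_eta_shearer (R : realType) (V : finType) (k : nat) (B : {set V})
    (p : V -> R) :
  (1 < k)%N -> #|B| = k ->
  (forall x, x \in B -> 0 <= p x) -> \sum_(x in B) p x = 1 ->
  shearer_const (k%:R - 1) * \sum_(x in B) eta (p x) <=
  \sum_(x in B) eta (1 - p x).
Proof.
case: k => // -[//|k] _; elim: k B p => [|k IH] B p cardB p0 p1.
  have /cards2P[a [b [ab BE]]] : #|B| == 2 by rewrite cardB.
  move: p0 p1; rewrite BE.
  have bE (F : V -> R) : \sum_(x in [set a; b]) F x = F a + F b.
    by rewrite big_setU1 ?inE //= big_set1.
  (* On two points the constant is 1, and [x |-> 1 - x] swaps the two atoms, so equality holds. *)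
  rewrite /shearer_const addrK ln1 mul0r subr0 !mul1r !bE => _ p1.
  have -> : p b = 1 - p a by rewrite -p1 addrC addKr.
  by rewrite opprB addrCA subrr addr0 addrC.
rewrite -addn1 natrD addrK.
by have [] := @sum_eta_step R V k.+2 B p isT cardB IH p0 p1.
Qed.

(** * From [eta] back to local entropies *)

Lemma ent_on_eta (R : realType) (V : finType) (B : {set V}) (f : V -> R) :
  (forall x, x \in B -> 0 <= f x) ->
  #|B|%:R * ent_on B f =
  (\sum_(x in B) f x) * ln #|B|%:R - \sum_(x in B) eta (f x)
  + eta (\sum_(x in B) f x).
Proof.
move=> f0; have [->|/finset.set0Pn[z zB]] := eqVneq B finset.set0.
  by rewrite cards0 !big_set0 eta0 !mul0r subr0 addr0.
set S := \sum_(x in B) f x.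
have m0 : 0 < #|B|%:R :> R by rewrite ltr0n; apply/card_gt0P; exists z.
rewrite /ent_on /mean -/S mulVKf ?gt_eqF //.
transitivity (\sum_(x in B) (f x * ln #|B|%:R - eta (f x) - f x * ln S)); last first.
  by rewrite !sumrB -!mulr_suml -/S [eta S]/eta mulNr.
apply: eq_bigr => x xB; have := f0 x xB.
rewrite le_eqVlt => /predU1P[<-|fx0]; first by rewrite eta0 !mul0r !subr0.
have S0 : 0 < S.
  apply: lt_le_trans fx0 _; rewrite /S (bigD1 x) //= lerDl sumr_ge0 // => y.
  by move=> /andP[/f0].
rewrite invfM invrK !lnM ?posrE ?mulr_gt0 ?invr_gt0 // lnV // /eta; ring.
Qed.

(** The functional [U] of the overview. Dividing by [ln #|B|%:R] gives a Dirac mass at a point of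
    [B] the value 1, whatever the size of [B] above 1. *)
Definition scaled_ent (R : realType) (V : finType) (f : V -> R) (B : {set V}) : R :=
  #|B|%:R * ent_on B f / ln #|B|%:R.

(** For [f = S * p], removing [x] leaves mass [1 - p x], which produces [eta (1 - p x)], and each
    atom survives in [#|B| - 1] of the sets [B :\ x]. The gap thus becomes [S / ln m] times that of
    [sum_eta_step]. *)
Lemma scaled_ent_step (R : realType) (V : finType) (B : {set V}) (f : V -> R) :
  (2 < #|B|)%N -> (forall x, 0 <= f x) ->
  (#|B|%:R - 1) * scaled_ent f B <= \sum_(x in B) scaled_ent f (B :\ x) /\
  ((forall x, x \in B -> f x != \sum_(y in B) f y) ->
   (exists2 x, x \in B & exists2 y, y \in B & f x != f y) ->
   (#|B|%:R - 1) * scaled_ent f B < \sum_(x in B) scaled_ent f (B :\ x)).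
Proof.
move=> B2 f0; set S := \sum_(y in B) f y.
have [k cardB] : exists k, #|B| = k.+1 by case: #|B| B2 => // k _; exists k.
have k1 : (1 < k)%N by rewrite cardB in B2.
have cardB' x : x \in B -> #|B :\ x| = k.
  by move=> xB; apply/succn_inj; rewrite -cardB (cardsD1 x B) xB.
set m : R := k%:R; have mE : #|B|%:R - 1 = m by rewrite cardB -addn1 natrD addrK.
have mE1 : #|B|%:R = m + 1 by rewrite -mE subrK.
have m1 : 1 < m by rewrite ltr1n.
have l0 : 0 < ln m by rewrite ln_gt0.
have L0 : 0 < ln (m + 1) by rewrite ln_gt0 // ltrDr (lt_trans _ m1).
rewrite mE; have S_ge0 : 0 <= S by rewrite sumr_ge0.
have [S_eq0|S_neq0] := eqVneq S 0.
  have fz x : x \in B -> f x = 0.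
    move=> xB; apply/eqP; rewrite eq_le f0 // andbT -S_eq0 /S (bigD1 x) //=.
    by rewrite lerDl sumr_ge0.
  have zero (A : {set V}) : A \subset B -> scaled_ent f A = 0.
    move=> /fintype.subsetP AB; rewrite /scaled_ent ent_on_eta //.
    have fA : {in A, f =1 fun=> 0} by move=> x /AB /fz.
    rewrite (eq_bigr _ fA) big1_eq (eq_bigr (fun=> 0)) => [|x /fA ->]; last exact: eta0.
    by rewrite big1_eq eta0 mul0r subr0 addr0 mul0r.
  split; last by move=> /[swap] -[x xB _] /(_ x xB); rewrite S_eq0 fz ?eqxx.
  by rewrite zero // mulr0 big1 // => x xB; rewrite zero // finset.subD1set.
have S0 : 0 < S by rewrite lt_neqAle eq_sym S_neq0.
pose p x := f x / S.
have fE x : f x = S * p x by rewrite /p mulrC divfK.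
have p0 x : 0 <= p x by rewrite divr_ge0.
have p1 : \sum_(x in B) p x = 1 by rewrite -mulr_suml divff.
have scaled (A : {set V}) : scaled_ent f A = S * (((\sum_(x in A) p x) * ln #|A|%:R
    - \sum_(x in A) eta (p x) + eta (\sum_(x in A) p x)) / ln #|A|%:R).
  rewrite /scaled_ent ent_on_eta // mulrA; congr (_ / _).
  have -> : \sum_(x in A) f x = S * \sum_(x in A) p x.
    by rewrite mulr_sumr; apply: eq_bigr => x _; rewrite fE.
  have -> : \sum_(x in A) eta (f x) =
      (\sum_(x in A) p x) * eta S + S * \sum_(x in A) eta (p x).
    rewrite mulr_suml mulr_sumr -big_split; apply: eq_bigr => x _.
    by rewrite fE etaM.
  by rewrite etaM ?sumr_ge0 //; ring.
set H := \sum_(x in B) eta (p x); set J := \sum_(x in B) eta (1 - p x).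
have whole : scaled_ent f B = S * ((ln (m + 1) - H) / ln (m + 1)).
  by rewrite scaled p1 mE1 eta1 addr0 mul1r.
have parts : \sum_(x in B) scaled_ent f (B :\ x) =
    S * ((m * ln m - m * H + J) / ln m).
  transitivity (S * (\sum_(x in B)
    ((1 - p x) * ln m - (H - eta (p x)) + eta (1 - p x)) / ln m)).
    rewrite mulr_sumr; apply: eq_bigr => x xB.
    rewrite scaled cardB' //; have -> : \sum_(y in B :\ x) p y = 1 - p x.
      by rewrite -p1 (big_setD1 x xB) /= addrAC subrr add0r.
    suff -> : \sum_(y in B :\ x) eta (p y) = H - eta (p x) by [].
    by rewrite /H (big_setD1 x xB) /= addrAC subrr add0r.
  congr (_ * _); rewrite -mulr_suml; congr (_ / _).
  rewrite big_split sumrB /= -mulr_suml !sumrB p1 !sumr_const -/H -/J.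
  by rewrite -mulr_natl mE1 -[H *+ _]mulr_natl mE1; ring.
have gap : \sum_(x in B) scaled_ent f (B :\ x) - m * scaled_ent f B =
    S / ln m * (J - shearer_const m * H).
  by rewrite whole parts /shearer_const; field; rewrite !gt_eqF.
have [ge gt] := @sum_eta_step R V k B p k1 cardB
  (fun B' q => @sum_eta_shearer R V k B' q k1) (fun x _ => p0 x) p1.
have coef : 0 < S / ln m by rewrite divr_gt0.
split=> [|nd nc]; first by rewrite -subr_ge0 gap pmulr_rge0 // subr_ge0.
rewrite -subr_gt0 gap pmulr_rgt0 // subr_gt0; apply: gt => [x xB|].
  by rewrite /p; apply: contra (nd x xB) => /eqP/(canRL (divfK S_neq0)) ->; rewrite mul1r.
have [x xB [y yB fxy]] := nc; exists x => //; exists y => //.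
by apply: contra fxy; rewrite !fE => /eqP ->.
Qed.

(** * Descent along the levels *)

Definition level_sum (R : realType) (V : finType) (U : {set V} -> R) (l : nat) : R :=
  \sum_(A : {set V} | #|A| == l) U A.

(** Double counting: a set [A] of size [l] is [B :\ x] exactly for [B = x |: A] with [x] outside
    [A]. *)
Lemma sum_level_setD1 (R : realType) (V : finType) (U : {set V} -> R) (l : nat) :
  \sum_(B : {set V} | #|B| == l.+1) \sum_(x in B) U (B :\ x) =
  (#|V| - l)%:R * level_sum U l.
Proof.
rewrite (exchange_big_dep xpredT) //= /level_sum mulr_sumr.
transitivity (\sum_(x : V) \sum_(A : {set V} | (#|A| == l) && (x \notin A)) U A).
  apply: eq_bigr => x _.
  rewrite (reindex_onto (fun A => x |: A) (fun B => B :\ x)) /=; last first.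
    by move=> B /andP[_ xB]; rewrite finset.setD1K.
  apply: eq_big => [A|A /andP[_ /eqP ->] //].
  rewrite setU11 andbT; have [xA|xA] := boolP (x \in A).
    rewrite andbF; apply/negbTE; rewrite negb_and; apply/orP; right.
    by apply: contraTneq xA => <-; rewrite !inE eqxx.
  by rewrite cardsU1 xA setU1K // eqxx add1n eqSS !andbT.
rewrite (exchange_big_dep (fun A : {set V} => #|A| == l)) /=; last first.
  by move=> x A _ /andP[].
apply: eq_bigr => A /eqP cA.
rewrite (eq_bigl (mem (finset.setC A))) => [|x]; last by rewrite cA eqxx /= inE.
by rewrite sumr_const -cA -(cardsC A) addKn mulr_natl.
Qed.

(** For [0 < l] the binomial counts the sets of size [l] through a given point, which is the level
    sum of a unit Dirac mass when [1 < l]. *)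
Definition level_gap (R : realType) (V : finType) (U : {set V} -> R) (l : nat) : R :=
  level_sum U l - 'C(#|V|.-1, l.-1)%:R * U [set: V]%SET.

Lemma level_sum_full (R : realType) (V : finType) (U : {set V} -> R) :
  level_sum U #|V| = U [set: V]%SET.
Proof.
rewrite /level_sum (big_pred1 [set: V]%SET) // => A /=.
apply/idP/eqP => [/eqP cA|->]; last by rewrite cardsT.
by apply/eqP; rewrite eqEcard finset.subsetT cardsT cA leqnn.
Qed.

(** The step summed over all sets of size [l + 1]; the terms in [U [set: V]] cancel by the
    absorption identity [bin]. *)
Lemma level_gap_step (R : realType) (V : finType) (U : {set V} -> R) (l : nat) :
  (0 < l < #|V|)%N ->
  (forall B : {set V}, #|B| = l.+1 ->
     (#|B|%:R - 1) * U B <= \sum_(x in B) U (B :\ x)) ->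
  l%:R * level_gap U l.+1 <= (#|V| - l)%:R * level_gap U l.
Proof.
move=> /andP[l0 ln] step.
have bin : l%:R * 'C(#|V|.-1, l)%:R = (#|V| - l)%:R * 'C(#|V|.-1, l.-1)%:R :> R.
  case: l l0 ln {step} => // l _ ln; rewrite -!natrM mul_bin_left.
  by case: #|V| ln.
rewrite /level_gap !mulrBr !mulrA bin lerD2r -sum_level_setD1 /level_sum mulr_sumr.
apply: ler_sum => B /eqP cB; apply: le_trans (step B cB).
by rewrite cB -addn1 natrD addrK.
Qed.

Lemma level_gap_full (R : realType) (V : finType) (U : {set V} -> R) :
  level_gap U #|V| = 0.
Proof. by rewrite /level_gap level_sum_full binn mul1r subrr. Qed.

Lemma level_gap_ge0 (R : realType) (V : finType) (U : {set V} -> R) (l : nat) :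
  (forall B : {set V}, (2 < #|B|)%N ->
     (#|B|%:R - 1) * U B <= \sum_(x in B) U (B :\ x)) ->
  (1 < l <= #|V|)%N -> 0 <= level_gap U l.
Proof.
(* Induction on [#|V| - l]: the gap is 0 at the full set and its sign is passed down to [l = 2]. *)
move=> step /andP[l1 ln]; rewrite -(subKn ln).
have : (1 < #|V| - (#|V| - l))%N by rewrite subKn.
elim: (#|V| - l)%N => [|i IH] l1'; first by rewrite subn0 level_gap_full.
set j := (#|V| - i.+1)%N in l1' *.
have jE : (#|V| - i = j.+1)%N by rewrite /j subnSK //; lia.
rewrite jE in IH; have := IH (ltnW l1') => {}IH.
have jV : (0 < j < #|V|)%N by rewrite /j; lia.
have := @level_gap_step R V U j jV (fun B cB => step B ltac:(by rewrite cB)).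
have : 0 <= j%:R * level_gap U j.+1 by rewrite mulr_ge0.
move=> /le_trans /[apply]; rewrite pmulr_rge0 // ltr0n subn_gt0.
by case/andP: jV.
Qed.

Lemma level_gap_pred (R : realType) (V : finType) (U : {set V} -> R) :
  (1 < #|V|)%N ->
  level_gap U #|V|.-1 =
  \sum_(x in [set: V]%SET) U ([set: V]%SET :\ x) - (#|V|%:R - 1) * U [set: V]%SET.
Proof.
move=> V1; have V0 := ltnW V1.
have := @sum_level_setD1 R V U #|V|.-1; rewrite prednK // -/(level_sum _ _).
rewrite level_sum_full -subn1 subKn // mul1r /level_gap => ->; congr (_ - _ * _).
case: #|V| V1 => [|[|j]] // _.
by rewrite /= binSn -[j.+2]addn1 natrD addrK.
Qed.

(** The same descent started at level [#|V| - 1], where the gap is the strict inequality assumed for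
    the full set; positive factors carry it down. *)
Lemma level_gap_gt0 (R : realType) (V : finType) (U : {set V} -> R) (l : nat) :
  (forall B : {set V}, (2 < #|B|)%N ->
     (#|B|%:R - 1) * U B <= \sum_(x in B) U (B :\ x)) ->
  (#|V|%:R - 1) * U [set: V]%SET <
    \sum_(x in [set: V]%SET) U ([set: V]%SET :\ x) ->
  (1 < l < #|V|)%N -> 0 < level_gap U l.
Proof.
move=> step top /andP[l1 ln].
have V1 : (1 < #|V|)%N by apply: ltn_trans ln.
have lV : (l <= #|V|.-1)%N by lia.
rewrite -(subKn lV).
have : (1 < #|V|.-1 - (#|V|.-1 - l))%N by rewrite subKn.
elim: (#|V|.-1 - l)%N => [|i IH] l1'.
  by rewrite subn0 level_gap_pred // subr_gt0.
set j := (#|V|.-1 - i.+1)%N in l1' *.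
have jE : (#|V|.-1 - i = j.+1)%N by rewrite /j; lia.
rewrite jE in IH; have := IH (ltnW l1') => {}IH.
have jV : (0 < j < #|V|)%N by rewrite /j; lia.
have := @level_gap_step R V U j jV (fun B cB => step B ltac:(by rewrite cB)).
have : 0 < j%:R * level_gap U j.+1 by rewrite mulr_gt0 // ltr0n ltnW.
move=> /lt_le_trans /[apply]; rewrite pmulr_rgt0 // ltr0n subn_gt0.
by case/andP: jV.
Qed.

(** * Dirac masses and conclusion *)

Lemma dirac_scaled_ent (R : realType) (V : finType) (c : R) (x0 : V)
    (f : V -> R) (B : {set V}) :
  0 <= c -> (forall x, f x = c * dirac_mass R x0 x) -> (1 < #|B|)%N ->
  scaled_ent f B = c * (x0 \in B)%:R.
Proof.
move=> c0 fE B1.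
have f0 x : 0 <= f x by rewrite fE mulr_ge0.
have fE' (F : R -> R) : F 0 = 0 -> \sum_(x in B) F (f x) = F c * (x0 \in B)%:R.
  move=> F0; have [x0B|x0B] := boolP (x0 \in B).
    rewrite (bigD1 x0) //= fE /dirac_mass eqxx !mulr1 big1 ?addr0 // => x /andP[_ xx0].
    by rewrite fE /dirac_mass (negbTE xx0) mulr0.
  rewrite mulr0 big1 // => x xB; rewrite fE /dirac_mass.
  by rewrite (_ : (x == x0) = false) ?mulr0 //; apply: contraNF x0B => /eqP <-.
rewrite /scaled_ent ent_on_eta // (fE' id) // fE' ?eta0 //.
have L : ln #|B|%:R != 0 :> R by rewrite gt_eqF // ln_gt0 // ltr1n.
case: (x0 \in B); first by rewrite !mulr1; field.
by rewrite !mulr0 eta0 mul0r subr0 addr0 mul0r.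
Qed.

(** For a Dirac mass the step is an equality, so [level_gap_ge0] applies to [scaled_ent f] and to
    its opposite. *)
Lemma dirac_level_gap (R : realType) (V : finType) (f : V -> R) (l : nat) :
  (forall x, 0 <= f x) -> dirac_multiple f -> (1 < l <= #|V|)%N ->
  level_gap (scaled_ent f) l = 0.
Proof.
move=> f0 [c [x0 fE]] lV.
have c0 : 0 <= c by have := f0 x0; rewrite fE /dirac_mass eqxx mulr1.
have eq_step (B : {set V}) : (2 < #|B|)%N ->
    (#|B|%:R - 1) * scaled_ent f B = \sum_(x in B) scaled_ent f (B :\ x).
  move=> B2; have B1 := ltnW B2.
  have lt1 x : x \in B -> (1 < #|B :\ x|)%N.
    by move=> xB; move: B2; rewrite (cardsD1 x B) xB.
  rewrite (eq_bigr (fun x => c * (x0 \in B :\ x)%:R)) => [|x xB]; last first.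
    by rewrite (dirac_scaled_ent c0 fE (lt1 x xB)).
  rewrite (dirac_scaled_ent c0 fE B1) -mulr_sumr mulrCA; congr (_ * _).
  have [x0B|x0B] := boolP (x0 \in B); last first.
    by rewrite mulr0 big1 // => x _; rewrite inE (negbTE x0B) andbF.
  rewrite mulr1 (big_setD1 x0 x0B) /= !inE eqxx add0r (cardsD1 x0 B) x0B natrD.
  rewrite addrAC subrr add0r.
  rewrite (eq_bigr (fun=> 1)) ?sumr_const // => x.
  by rewrite !inE x0B andbT eq_sym => /andP[->].
have opp : level_gap (fun A => - scaled_ent f A) l = - level_gap (scaled_ent f) l.
  by rewrite /level_gap /level_sum sumrN mulrN opprB opprK addrC.
apply/eqP; rewrite eq_le -oppr_ge0 -opp !level_gap_ge0 // => B /eq_step h.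
  by rewrite h.
by rewrite mulrN h sumrN.
Qed.

Lemma Ent_scaled_ent (R : realType) (V : finType) (f : V -> R) :
  (1 < #|V|)%N ->
  Ent f = #|V|%:R^-1 * (ln #|V|%:R * scaled_ent f [set: V]%SET).
Proof.
move=> V1; rewrite /scaled_ent cardsT [ln _ * _]mulrC divfK; last first.
  by rewrite gt_eqF // ln_gt0 // ltr1n.
rewrite mulKf ?pnatr_eq0 -?lt0n 1?ltnW // /ent_on /mean /Ent /unif cardsT.
have T (F : V -> R) : \sum_x F x = \sum_(x in [set: V]%SET) F x.
  by apply: eq_bigl => x; rewrite inE.
by rewrite !T.
Qed.

(** The deficit in the entropy inequality is a combination of level gaps with nonnegative
    coefficients when [w] is nonnegative, so both the inequality and its equality cases are read off
    from the gaps. *)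
Lemma local_ent_gap (R : realType) (V : finType) (n : nat) (w : nat -> R)
    (alpha : {set V} -> R) (f : V -> R) :
  #|V| = n -> (1 < n)%N ->
  (forall A : {set V}, alpha A = \sum_(2 <= l < n.+1) w l * level_weights R l A) ->
  local_ent alpha f -
  (\sum_(2 <= l < n.+1) w l * ('C(n.-1, l.-1)%:R * ln l%:R / ln n%:R)) * Ent f =
  n%:R^-1 * \sum_(2 <= l < n.+1) w l * (ln l%:R * level_gap (scaled_ent f) l).
Proof.
move=> cV n1 alphaE.
have lnn : ln n%:R != 0 :> R by rewrite gt_eqF // ln_gt0 // ltr1n.
rewrite /local_ent Ent_scaled_ent cV //; set K := (X in X * (n%:R^-1 * _)).
rewrite [K * _]mulrCA -mulrBr {}/K; congr (_ * _).
have -> : \sum_(A : {set V}) #|A|%:R * alpha A * ent_on A f =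
    \sum_(2 <= l < n.+1) w l * (ln l%:R * level_sum (scaled_ent f) l).
  transitivity (\sum_(A : {set V}) \sum_(2 <= l < n.+1)
      w l * ((#|A| == l)%:R * (#|A|%:R * ent_on A f))).
    apply: eq_bigr => A _; rewrite alphaE mulrAC mulr_sumr.
    by apply: eq_bigr => l _; rewrite /level_weights; ring.
  rewrite exchange_big /=; apply: eq_big_nat => l /andP[l2 _].
  rewrite -mulr_sumr; congr (_ * _); rewrite /level_sum mulr_sumr [RHS]big_mkcond /=.
  apply: eq_bigr => A _; case: eqP => [cA|_]; last by rewrite mul0r.
  rewrite mul1r /scaled_ent cA [RHS]mulrC divfK ?gt_eqF ?ln_gt0 ?ltr1n //.
rewrite mulr_suml -sumrB; apply: eq_bigr => l _; rewrite /level_gap cV.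
by field.
Qed.

(* Uniqueness is up to the trivial cases of equality: constant f (both sides
   vanish), and w_l = 0 for all l < n (then the inequality is an identity). *)
Theorem theorem1p1 (R : realType) (V : finType) (n : nat) (w : nat -> R)
    (alpha : {set V} -> R) (kappa : R)
    (card_V : #|V| = n) (n_gt1 : (1 < n)%N)
    (w_ge0 : forall l : nat, (2 <= l <= n)%N -> 0 <= w l)
    (alphaE : forall A : {set V},
       alpha A = \sum_(2 <= l < n.+1) w l * level_weights R l A)
    (kappaE : kappa = \sum_(2 <= l < n.+1)
       w l * ('C(n.-1, l.-1)%:R * ln (l%:R : R) / ln (n%:R : R))) :
  is_entropy_constant alpha kappa /\
  (forall f : V -> R, (forall x, 0 <= f x) ->
     dirac_multiple f -> kappa * Ent f = local_ent alpha f) /\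
  ((exists2 l : nat, (2 <= l < n)%N & 0 < w l) ->
   forall f : V -> R, (forall x, 0 <= f x) -> ~ constant_fun f ->
     kappa * Ent f = local_ent alpha f -> dirac_multiple f).
Proof.
have n0 : 0 < n%:R :> R by rewrite ltr0n ltnW.
have ln_pos l : (1 < l)%N -> 0 < ln l%:R :> R.
  by move=> l1; rewrite ln_gt0 // ltr1n.
have gapE f := local_ent_gap f card_V n_gt1 alphaE.
rewrite -kappaE in gapE.
have gap_ge0 (f : V -> R) l : (forall x, 0 <= f x) -> (2 <= l <= n)%N ->
    0 <= level_gap (scaled_ent f) l.
  move=> f0 ln; apply: level_gap_ge0; last by rewrite card_V.
  by move=> B B2; have [] := scaled_ent_step B2 f0.
have term_ge0 (f : V -> R) l : (forall x, 0 <= f x) -> (2 <= l <= n)%N ->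
    0 <= w l * (ln l%:R * level_gap (scaled_ent f) l).
  move=> f0 lb; have /andP[l2 _] := lb.
  by rewrite !mulr_ge0 ?w_ge0 ?gap_ge0 // ltW // ln_pos.
have dirac_eq (f : V -> R) : (forall x, 0 <= f x) -> dirac_multiple f ->
    kappa * Ent f = local_ent alpha f.
  move=> f0 df; apply/esym/eqP; rewrite -subr_eq0 gapE mulf_eq0; apply/orP; right.
  rewrite big_nat big1 // => l lb; rewrite dirac_level_gap ?mulr0 // card_V.
  by move: lb; rewrite ltnS.
split; [split|split] => //.
- split.
    rewrite kappaE big_nat sumr_ge0 // => l; rewrite ltnS => lb.
    have /andP[l2 _] := lb.
    by rewrite mulr_ge0 ?w_ge0 // divr_ge0 ?mulr_ge0 // ltW // ln_pos.
  move=> f f0; rewrite -subr_ge0 gapE mulr_ge0 ?invr_ge0 ?(ltW n0) //.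
  rewrite big_nat sumr_ge0 // => l; rewrite ltnS; exact: term_ge0.
(* Test on a Dirac mass: it gives equality with [kappa], and its entropy is positive. *)
- move=> k [_ kP].
  have /card_gt0P[x0 _] : (0 < #|V|)%N by rewrite card_V ltnW.
  have d0 x : 0 <= dirac_mass R x0 x by [].
  have df : dirac_multiple (dirac_mass R x0) by exists 1, x0 => x; rewrite mul1r.
  have := kP _ d0; rewrite -(dirac_eq _ d0 df) ler_pM2r //.
  rewrite Ent_scaled_ent card_V // (dirac_scaled_ent ler01 (x0 := x0)).
  - by rewrite inE mulr1 mulr1 mulr_gt0 ?invr_gt0 // ln_pos.
  - by move=> x; rewrite mul1r.
  - by rewrite cardsT card_V.
move=> [l /andP[l2 ln] wl] f f0 nconst eq_f; apply: contrapT => ndirac.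
have T2 : (2 < #|[set: V]%SET|)%N by rewrite cardsT card_V (leq_ltn_trans l2).
have top : (#|V|%:R - 1) * scaled_ent f [set: V]%SET <
    \sum_(x in [set: V]%SET) scaled_ent f ([set: V]%SET :\ x).
  have [_] := scaled_ent_step T2 f0; rewrite cardsT; apply.
    (* A value equal to the total leaves nothing for the other points, so [f] would be a Dirac
       multiple. *)
    move=> x0 _; apply/eqP => fx0; apply: ndirac; exists (f x0), x0 => x.
    rewrite /dirac_mass; have [->|xx0] := eqVneq x x0; first by rewrite mulr1.
    rewrite mulr0; apply/eqP; rewrite eq_le f0 andbT -(lerD2l (f x0)) addr0.
    rewrite [leRHS]fx0 (bigD1 x0) //= lerD2l (bigD1 x) ?inE //= lerDl.
    by rewrite sumr_ge0.
  apply: contrapT => h; apply: nconst.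
  have /card_gt0P[x0 _] : (0 < #|V|)%N by rewrite card_V ltnW.
  exists (f x0) => x; apply/eqP; apply: contrapT => /negP fx; apply: h.
  by exists x; rewrite ?inE //; exists x0; rewrite ?inE.
have gap_gt0 : 0 < level_gap (scaled_ent f) l.
  apply: level_gap_gt0 => //; last by rewrite card_V l2.
  by move=> B B2; have [] := scaled_ent_step B2 f0.
(* Equality makes a sum of nonnegative terms vanish, while its term at [l] is positive. *)
have := gapE f; rewrite eq_f subrr => /esym/eqP; rewrite mulf_eq0 gt_eqF ?invr_gt0 //=.
rewrite big_nat psumr_eq0 => [|i]; last by rewrite ltnS; exact: term_ge0.
move=> /allP/(_ l); rewrite mem_index_iota l2 ltnS (ltnW ln) => /(_ isT) /=.
by rewrite gt_eqF // !mulr_gt0 // ln_pos.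
Qed.
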